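(* Let $A,B,C$ be unital associative algebras over $\mathbb C$, with algebra homomorphisms $C\xrightarrow{\varphi}B\xrightarrow{\pi}A$. Then $$\mathrm{Ind}^A_B(-)\circ\mathrm{Ind}^B_C(-)\cong\mathrm{Ind}^A_C(-)$$ as functors from $\mathsf{Mod}(C)$ to $\mathsf{Mod}(A)$, where $\mathrm{Ind}^A_C$ is defined via the algebra homomorphism $\pi\circ\varphi:C\to A$.
   Context: $\mathsf{Mod}(A)$ is the category of left $A$-modules. For a homomorphism $\pi:B\to A$ of unital associative algebras and a left $B$-module $\Omega_M$, the quotient $\Omega_M/\ker(\pi).\Omega_M$ is a left $\pi(B)$-module via $\pi(b).\bar v=\overline{b.v}$, and $$\mathrm{Ind}_B^A(\Omega_M)=A\otimes_{\pi(B)}\left(\Omega_M/\ker(\pi).\Omega_M\right);$$ on a morphism $f:\Omega_M\to\Omega_W$, $\mathrm{Ind}_B^A(f)(a\otimes\bar v)=a\otimes\overline{f(v)}$. *)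

(* Defs.v *)
From HB Require Import structures.
From mathcomp Require Import all_boot all_order all_algebra.
From mathcomp Require Import boolp reals.
From mathcomp Require Import complex freeg.

Set Implicit Arguments.
Unset Strict Implicit.
Unset Printing Implicit Defensive.

Import GRing.Theory.
Local Open Scope ring_scope.
Local Open Scope quotient_scope.

Record category := Category {
  Ob :> Type;
  Hom : Ob -> Ob -> Type;
  idm : forall x, Hom x x;
  cmp : forall x y z, Hom y z -> Hom x y -> Hom x z;
  cmp1m : forall x y (f : Hom x y), cmp (idm y) f = f;
  cmpm1 : forall x y (f : Hom x y), cmp f (idm x) = f;
  cmpA : forall x y z t (f : Hom z t) (g : Hom y z) (h : Hom x y),
    cmp f (cmp g h) = cmp (cmp f g) h }.

Arguments Hom {c} _ _.
Arguments idm {c} _.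
Arguments cmp {c x y z} _ _.

Record functor (C D : category) := Functor {
  fobj :> C -> D;
  fmap : forall x y : C, Hom x y -> Hom (fobj x) (fobj y);
  fmap_id : forall x : C, fmap (idm x) = idm (fobj x);
  fmap_cmp : forall (x y z : C) (g : Hom y z) (f : Hom x y),
    fmap (cmp g f) = cmp (fmap g) (fmap f) }.

Arguments fmap {C D} _ {x y} _.

Section FunctorComp.
Variables (C D E : category) (G : functor D E) (F : functor C D).

Lemma fcomp_id (x : C) : fmap G (fmap F (idm x)) = idm (G (F x)).
Proof. by rewrite !fmap_id. Qed.

Lemma fcomp_cmp (x y z : C) (g : Hom y z) (f : Hom x y) :
  fmap G (fmap F (cmp g f)) = cmp (fmap G (fmap F g)) (fmap G (fmap F f)).
Proof. by rewrite !fmap_cmp. Qed.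

Definition fcomp : functor C E :=
  @Functor C E (fun x => G (F x)) (fun x y f => fmap G (fmap F f))
    fcomp_id fcomp_cmp.

End FunctorComp.

Definition natural (C D : category) (F G : functor C D)
    (eta : forall x : C, Hom (F x) (G x)) : Prop :=
  forall (x y : C) (f : Hom x y), cmp (eta y) (fmap F f) = cmp (fmap G f) (eta x).

Definition is_iso (C : category) (x y : C) (f : Hom x y) : Prop :=
  exists g : Hom y x, cmp g f = idm x /\ cmp f g = idm y.

Definition nat_iso (C D : category) (F G : functor C D) : Prop :=
  exists eta : forall x : C, Hom (F x) (G x),
    natural eta /\ forall x, is_iso (eta x).

Section Mod.
Variable A : pzRingType.

Lemma linear_ext (M N : lmodType A) (f g : {linear M -> N}) : f =1 g -> f = g.
Proof.
case: f g => [f [mf sf]] [g [mg sg]] /= /funext fg; subst g.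
case: mf sf mg sg => [[af bf]] [sf] [[ag bg]] [sg].
by have -> : af = ag by []; rewrite (Prop_irrelevance bf bg) (Prop_irrelevance sf sg).
Qed.

Definition Mod : category.
Proof.
refine (@Category (lmodType A) (fun M N => {linear M -> N})
  (fun M => idfun) (fun M N P g f => g \o f) _ _ _) => *;
  exact: linear_ext.
Defined.

End Mod.

(* Algebras are possibly zero, hence not the library's algType, which imposes
   1 != 0. *)
Record ualgType (K : comPzRingType) := UAlg {
  ualg_ring :> pzRingType;
  ualg_scale : K -> ualg_ring -> ualg_ring;
  ualg_scaleA : forall k l x, ualg_scale k (ualg_scale l x) = ualg_scale (k * l) x;
  ualg_scale1 : forall x, ualg_scale 1 x = x;
  ualg_scaleDr : forall k x y, ualg_scale k (x + y) = ualg_scale k x + ualg_scale k y;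
  ualg_scaleDl : forall k l x, ualg_scale (k + l) x = ualg_scale k x + ualg_scale l x;
  ualg_scaleAl : forall k x y, ualg_scale k (x * y) = ualg_scale k x * y;
  ualg_scaleAr : forall k x y, ualg_scale k (x * y) = x * ualg_scale k y }.

Record ualgHom (K : comPzRingType) (A B : ualgType K) := UAlgHom {
  ualg_rmorph :> {rmorphism A -> B};
  ualg_rmorphZ : forall k x,
    ualg_rmorph (ualg_scale k x) = ualg_scale k (ualg_rmorph x) }.

Section UAlgComp.
Variables (K : comPzRingType) (A B C : ualgType K).
Variables (g : ualgHom B A) (f : ualgHom C B).

Lemma ualg_comp_scale k x :
  (g \o f) (ualg_scale k x) = ualg_scale k ((g \o f) x).
Proof. by rewrite /= !ualg_rmorphZ. Qed.

Definition ualg_comp : ualgHom C A := UAlgHom ualg_comp_scale.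

End UAlgComp.

Inductive zgen (V : zmodType) (P : V -> Prop) : V -> Prop :=
| zgen0 : zgen P 0
| zgen_in x : P x -> zgen P x
| zgenB x y : zgen P x -> zgen P y -> zgen P (x - y).

Definition zspan (V : zmodType) (P : V -> Prop) : {pred V} :=
  fun x => `[< zgen P x >].

Section ZSpan.
Variables (V : zmodType) (P : V -> Prop).

Lemma zspanP x : reflect (zgen P x) (x \in zspan P).
Proof. exact: asboolP. Qed.

Lemma zspan_zmod_closed : zmod_closed (zspan P).
Proof.
split; first by apply/zspanP; exact: zgen0.
by move=> x y /zspanP Px /zspanP Py; apply/zspanP; exact: zgenB.
Qed.

HB.instance Definition _ := GRing.isZmodClosed.Build V (zspan P) zspan_zmod_closed.

End ZSpan.

Definition zquot (V : zmodType) (P : V -> Prop) : Type := @Quotient.quot V (zspan P).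

Section ZQuot.
Variables (V : zmodType) (P : V -> Prop).
Local Notation Q := (zquot P).

HB.instance Definition _ := Choice.on Q.
HB.instance Definition _ := GRing.Zmodule.on Q.

Definition zclass (x : V) : Q := \pi_(@Quotient.quot V (zspan P)) x.

Lemma zclass_zmod : zmod_morphism zclass.
Proof. by move=> x y; rewrite /zclass raddfB. Qed.
HB.instance Definition _ := GRing.isZmodMorphism.Build V Q zclass zclass_zmod.

Lemma zclassP (q : Q) : exists x, q = zclass x.
Proof. by exists (repr q); rewrite /zclass reprK. Qed.

Lemma zclass_eq0 x : zclass x = 0 <-> zgen P x.
Proof.
split.
  move=> h; apply/zspanP; rewrite -[x]subr0 Quotient.idealrBE.
  by apply/eqP; rewrite -/(zclass x) h -/(zclass 0) raddf0.
move=> /zspanP; rewrite -[x in x \in _]subr0 Quotient.idealrBE => /eqP h.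
by rewrite -(raddf0 zclass).
Qed.

Lemma zquot_ext (W : zmodType) (f g : {additive Q -> W}) :
  (forall x, f (zclass x) = g (zclass x)) -> f =1 g.
Proof. by move=> fg q; have [x ->] := zclassP q. Qed.

Section Lift.
Variables (W : zmodType) (f : {additive V -> W}).

(* The map induced on the quotient by an additive f that vanishes on P *)
Definition zlift (fP : forall x, P x -> f x = 0) (q : Q) : W := f (repr q).

Hypothesis fP : forall x, P x -> f x = 0.

Lemma zliftE x : zlift fP (zclass x) = f x.
Proof.
apply/eqP; rewrite -subr_eq0 -raddfB /zlift; apply/eqP.
have: zgen P (repr (zclass x) - x).
  by apply/zclass_eq0; rewrite raddfB /= {1}/zclass reprK subrr.
elim=> [|y /fP//|y z _ fy _ fz]; first by rewrite raddf0.
by rewrite raddfB fy fz subrr.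
Qed.

Lemma zlift_zmod : zmod_morphism (zlift fP).
Proof.
by move=> p q; have [x ->] := zclassP p; have [y ->] := zclassP q;
  rewrite -raddfB !zliftE raddfB.
Qed.
HB.instance Definition _ := GRing.isZmodMorphism.Build Q W (zlift fP) zlift_zmod.

End Lift.
End ZQuot.

Section Image.
Variables (B A : pzRingType) (p : {rmorphism B -> A}).

Definition im_pred : {pred A} := fun a => `[< exists b, p b = a >].

Lemma im_predP a : reflect (exists b, p b = a) (a \in im_pred).
Proof. exact: asboolP. Qed.

Lemma im_subring_closed : subring_closed im_pred.
Proof.
split; first by apply/im_predP; exists 1; rewrite rmorph1.
  move=> _ _ /im_predP[x <-] /im_predP[y <-]; apply/im_predP.
  by exists (x - y); rewrite rmorphB.
move=> _ _ /im_predP[x <-] /im_predP[y <-]; apply/im_predP.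
by exists (x * y); rewrite rmorphM.
Qed.

Record im_ring := ImRing { im_val : A; im_valP : im_val \in im_pred }.

HB.instance Definition _ := [isSub for im_val].
HB.instance Definition _ := [Choice of im_ring by <:].
HB.instance Definition _ :=
  GRing.SubChoice_isSubPzRing.Build A im_pred im_ring im_subring_closed.

Lemma im_ex (s : im_ring) : exists b, p b = val s.
Proof. by apply/im_predP; exact: valP. Qed.

Definition im_lift (s : im_ring) : B := projT1 (cid (im_ex s)).

Lemma im_liftK s : p (im_lift s) = val s.
Proof. exact: (projT2 (cid (im_ex s))). Qed.

End Image.

Section Coker.
Variables (B A : pzRingType) (p : {rmorphism B -> A}).

(* ker(p).M is the subgroup generated by the b.v with b in ker(p); it is a
   submodule because ker(p) is a two-sided ideal. *)
Definition kerM_gen (M : lmodType B) (x : M) : Prop :=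
  exists b v, p b = 0 /\ x = b *: v.

Definition quotker (M : lmodType B) : Type := zquot (@kerM_gen M).

Section QuotkerModule.
Variable M : lmodType B.

HB.instance Definition _ := GRing.Zmodule.on (quotker M).

Definition qclass (v : M) : quotker M := zclass (@kerM_gen M) v.

Lemma qclass_zmod : zmod_morphism qclass.
Proof. exact: zclass_zmod. Qed.
HB.instance Definition _ := GRing.isZmodMorphism.Build M (quotker M) qclass qclass_zmod.

Lemma qclassP (x : quotker M) : exists v, x = qclass v.
Proof. exact: zclassP. Qed.

Lemma qclass_ker b v : p b = 0 -> qclass (b *: v) = 0.
Proof. by move=> pb; apply/zclass_eq0/zgen_in; exists b, v. Qed.

Lemma qscale_ker b x : @kerM_gen M x -> (qclass \o *:%R b) x = 0.
Proof.
move=> [k [v [pk ->]]]; rewrite /= scalerA qclass_ker //.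
by rewrite rmorphM pk mulr0.
Qed.

(* p(b) acts on the class of v by the class of b.v *)
Definition qscale (s : im_ring p) : quotker M -> quotker M :=
  zlift (@qscale_ker (im_lift s)).

Lemma qscaleE s b v : p b = val s -> qscale s (qclass v) = qclass (b *: v).
Proof.
move=> pb; rewrite /qscale [LHS]zliftE /=; apply/eqP.
rewrite -subr_eq0 -raddfB -scalerBl; apply/eqP/qclass_ker.
by rewrite rmorphB im_liftK pb subrr.
Qed.

Lemma qscaleA s t x : qscale s (qscale t x) = qscale (s * t) x.
Proof.
have [v ->] := qclassP x.
rewrite (qscaleE _ (im_liftK t)) (qscaleE _ (im_liftK s)) scalerA.
by rewrite (@qscaleE _ (im_lift s * im_lift t)) // rmorphM !im_liftK rmorphM.
Qed.

Lemma qscale1 : left_id 1 qscale.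
Proof.
move=> x; have [v ->] := qclassP x.
by rewrite (@qscaleE _ 1) ?scale1r // !rmorph1.
Qed.

Lemma qscaleDr : right_distributive qscale +%R.
Proof. by move=> s x y; rewrite /qscale raddfD. Qed.

Lemma qscaleDl x : {morph qscale^~ x : s t / s + t}.
Proof.
move=> s t; have [v ->] := qclassP x.
rewrite (qscaleE _ (im_liftK s)) (qscaleE _ (im_liftK t)).
rewrite (@qscaleE _ (im_lift s + im_lift t)); last by rewrite rmorphD !im_liftK rmorphD.
by rewrite scalerDl raddfD.
Qed.

HB.instance Definition _ := GRing.Zmodule_isLmodule.Build (im_ring p) (quotker M)
  qscaleA qscale1 qscaleDr qscaleDl.

Lemma qclassZ s b v : p b = val s -> s *: qclass v = qclass (b *: v).
Proof. exact: qscaleE. Qed.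

End QuotkerModule.

Section QuotkerMap.
Variables (M N : lmodType B) (f : {linear M -> N}).

Lemma qmap_ker x : @kerM_gen M x -> (qclass (M := N) \o f) x = 0.
Proof. by move=> [b [v [pb ->]]]; rewrite /= linearZ qclass_ker. Qed.

Definition qmap : quotker M -> quotker N := zlift qmap_ker.

Lemma qmap_zmod : zmod_morphism qmap.
Proof. exact: zlift_zmod. Qed.
HB.instance Definition _ := GRing.isZmodMorphism.Build (quotker M) (quotker N) qmap qmap_zmod.

Lemma qmapE v : qmap (qclass v) = qclass (f v).
Proof. exact: zliftE. Qed.

Lemma qmap_scalable : scalable qmap.
Proof.
move=> s x; have [v ->] := qclassP x.
by rewrite (qclassZ _ (im_liftK s)) !qmapE linearZ (qclassZ _ (im_liftK s)).
Qed.
HB.instance Definition _ := GRing.isScalable.Build _ _ _ _ qmap qmap_scalable.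

End QuotkerMap.
End Coker.

Arguments qclass {B A} p {M} v.
Arguments qmap {B A} p {M N} f.

(* tens N is the tensor product A (x)_S N, with A a right S-module through i:
   the free abelian group on A * N modulo the relations tens_rel. *)
Section Tensor.
Variables (S A : pzRingType) (i : {rmorphism S -> A}).

Section TensorProduct.
Variable N : lmodType S.
Local Notation F := {freeg (A * N)%type / int}.

Definition tgen (a : A) (n : N) : F := << (a, n) >>.

Inductive tens_rel : F -> Prop :=
| tens_addl a a' n : tens_rel (tgen (a + a') n - tgen a n - tgen a' n)
| tens_addr a n n' : tens_rel (tgen a (n + n') - tgen a n - tgen a n')
| tens_bal a s n : tens_rel (tgen (a * i s) n - tgen a (s *: n)).

Definition tens : Type := zquot tens_rel.

HB.instance Definition _ := GRing.Zmodule.on tens.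

Definition tensor (a : A) (n : N) : tens := zclass tens_rel (tgen a n).

Lemma tensorDl a a' n : tensor (a + a') n = tensor a n + tensor a' n.
Proof.
apply/eqP; rewrite -subr_eq0 opprD addrA -!raddfB; apply/eqP.
by apply/zclass_eq0/zgen_in/tens_addl.
Qed.

Lemma tensorDr a n n' : tensor a (n + n') = tensor a n + tensor a n'.
Proof.
apply/eqP; rewrite -subr_eq0 opprD addrA -!raddfB; apply/eqP.
by apply/zclass_eq0/zgen_in/tens_addr.
Qed.

Lemma tensor_bal a s n : tensor (a * i s) n = tensor a (s *: n).
Proof.
apply/eqP; rewrite -subr_eq0 -!raddfB; apply/eqP.
by apply/zclass_eq0/zgen_in/tens_bal.
Qed.

Lemma tens_ext (W : zmodType) (f g : {additive tens -> W}) :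
  (forall a n, f (tensor a n) = g (tensor a n)) -> f =1 g.
Proof.
move=> fg; apply: zquot_ext => x; rewrite -[x]freeg_sumE !raddf_sum.
apply: eq_bigr => -[a n] _; rewrite -[coeff _ _]intz -freegU_mulz.
rewrite -/(tgen a n) !raddfMz; congr (_ *~ _); exact: fg.
Qed.

Record balanced (W : zmodType) (g : A -> N -> W) : Prop := Balanced {
  balDl : forall a a' n, g (a + a') n = g a n + g a' n;
  balDr : forall a n n', g a (n + n') = g a n + g a n';
  bal_mid : forall a s n, g (a * i s) n = g a (s *: n) }.

Section Lift.
Variables (W : zmodType) (g : A -> N -> W).

Definition fgsum : F -> W := fglift (fun x : A * N => g x.1 x.2 : zmodule W).

Lemma fgsum_zmod : zmod_morphism fgsum.
Proof. by move=> x y; rewrite [LHS](@lift_is_additive int _ (zmodule W)). Qed.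
HB.instance Definition _ := GRing.isZmodMorphism.Build F W fgsum fgsum_zmod.

Lemma fgsumU a n : fgsum (tgen a n) = g a n.
Proof. by rewrite /fgsum /tgen liftU scale1r. Qed.

Hypothesis gP : balanced g.

Lemma fgsum_rel x : tens_rel x -> fgsum x = 0.
Proof.
case=> [a a' n|a n n'|a s n]; rewrite !raddfB /= !fgsumU.
- by rewrite (balDl gP) addrAC addrK subrr.
- by rewrite (balDr gP) addrAC addrK subrr.
- by rewrite (bal_mid gP) subrr.
Qed.

Definition tlift : tens -> W := zlift fgsum_rel.

Lemma tlift_zmod : zmod_morphism tlift.
Proof. exact: zlift_zmod. Qed.
HB.instance Definition _ := GRing.isZmodMorphism.Build tens W tlift tlift_zmod.

Lemma tliftE a n : tlift (tensor a n) = g a n.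
Proof. by rewrite /tlift [LHS]zliftE /= fgsumU. Qed.

End Lift.

Lemma balanced_mul a : balanced (fun x n => tensor (a * x) n).
Proof.
split=> [x y n|x n n'|x s n]; first by rewrite mulrDr tensorDl.
  by rewrite tensorDr.
by rewrite mulrA tensor_bal.
Qed.

Definition tscale (a : A) : tens -> tens := tlift (balanced_mul a).

Lemma tscale_zmod a : zmod_morphism (tscale a).
Proof. exact: tlift_zmod. Qed.
HB.instance Definition _ a :=
  GRing.isZmodMorphism.Build tens tens (tscale a) (tscale_zmod a).

Lemma tscaleE a x n : tscale a (tensor x n) = tensor (a * x) n.
Proof. exact: tliftE. Qed.

Lemma tscaleA a b t : tscale a (tscale b t) = tscale (a * b) t.
Proof.
move: t; apply: (@tens_ext _ (tscale a \o tscale b) (tscale (a * b))) => x n.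
by rewrite /= !tscaleE mulrA.
Qed.

Lemma tscale1 : left_id 1 tscale.
Proof. by apply: (@tens_ext _ (tscale 1) idfun) => x n; rewrite /= tscaleE mul1r. Qed.

Lemma tscaleDr : right_distributive tscale +%R.
Proof. by move=> a x y; rewrite raddfD. Qed.

Lemma tscaleDl t : {morph tscale^~ t : a b / a + b}.
Proof.
move=> a b; move: t.
apply: (@tens_ext _ (tscale (a + b)) (tscale a \+ tscale b)) => x n.
by rewrite /= !tscaleE mulrDl tensorDl.
Qed.

HB.instance Definition _ := GRing.Zmodule_isLmodule.Build A tens
  tscaleA tscale1 tscaleDr tscaleDl.

Lemma tensorZ a x n : a *: tensor x n = tensor (a * x) n.
Proof. exact: tscaleE. Qed.

End TensorProduct.

Section TensorMap.
Variables (N N' : lmodType S) (f : {linear N -> N'}).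

Lemma balanced_map : balanced (fun a n => tensor a (f n)).
Proof.
split=> [a a' n|a n n'|a s n]; first exact: tensorDl.
  by rewrite linearD tensorDr.
by rewrite linearZ tensor_bal.
Qed.

Definition tmap : tens N -> tens N' := tlift balanced_map.

Lemma tmap_zmod : zmod_morphism tmap.
Proof. exact: tlift_zmod. Qed.
HB.instance Definition _ := GRing.isZmodMorphism.Build (tens N) (tens N') tmap tmap_zmod.

Lemma tmapE a n : tmap (tensor a n) = tensor a (f n).
Proof. exact: tliftE. Qed.

Lemma tmap_scalable : scalable tmap.
Proof.
move=> a; apply: (@tens_ext _ _ (tmap \o *:%R a) ( *:%R a \o tmap)) => x n.
by rewrite /= tensorZ !tmapE tensorZ.
Qed.
HB.instance Definition _ := GRing.isScalable.Build _ _ _ _ tmap tmap_scalable.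

End TensorMap.
End Tensor.

Arguments tens {S A} i N.
Arguments tensor {S A} i {N} a n.
Arguments tmap {S A} i {N N'} f.

(* The left B-module M is sent to A (x)_{p(B)} (M / ker(p).M). Only the ring
   structures enter: a left module over a K-algebra is a left module over the
   underlying ring, K acting through the unit. *)

Section Ind.
Variables (B A : pzRingType) (p : {rmorphism B -> A}).

Definition Ind_obj (M : Mod B) : Mod A :=
  tens (val : im_ring p -> A) (quotker p M).

Definition Ind_map (M N : Mod B) (f : Hom M N) : Hom (Ind_obj M) (Ind_obj N) :=
  tmap (val : im_ring p -> A) (qmap p f).

Lemma Ind_mapE (M N : Mod B) (f : {linear M -> N}) a v :
  (@Ind_map M N f : {linear Ind_obj M -> Ind_obj N})
    (tensor (val : im_ring p -> A) a (qclass p v)) =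
  tensor (val : im_ring p -> A) a (qclass p (f v)).
Proof. by rewrite /Ind_map /= tmapE /= qmapE. Qed.

Lemma Ind_ext (M : Mod B) (W : Mod A) (f g : {linear Ind_obj M -> W}) :
  (forall a v, f (tensor (val : im_ring p -> A) a (qclass p v)) =
               g (tensor (val : im_ring p -> A) a (qclass p v))) -> f = g.
Proof.
move=> fg; apply: linear_ext; apply: tens_ext => a n.
have [v ->] := qclassP n.
exact: fg.
Qed.

Lemma Ind_map_id (M : Mod B) : Ind_map (idm M) = idm (Ind_obj M).
Proof. by apply: Ind_ext => a v; rewrite Ind_mapE. Qed.

Lemma Ind_map_cmp (M N P : Mod B) (g : Hom N P) (f : Hom M N) :
  Ind_map (cmp g f) = cmp (Ind_map g) (Ind_map f).
Proof.
apply: Ind_ext => a v; rewrite Ind_mapE.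
rewrite -[RHS]/(Ind_map g (Ind_map f (tensor _ a (qclass p v)))).
by rewrite !Ind_mapE; exact: erefl.
Qed.

Definition Ind : functor (Mod B) (Mod A) := Functor Ind_map_id Ind_map_cmp.

End Ind.

(* Main.v *)
Require Import Defs.
From HB Require Import structures.
From mathcomp Require Import all_boot all_order all_algebra.
From mathcomp Require Import reals complex.

Local Open Scope ring_scope.
Local Open Scope complex_scope.

Set Implicit Arguments.
Unset Strict Implicit.
Unset Printing Implicit Defensive.

Import GRing.Theory.

(** Both quotienting by [ker p] and tensoring over the image of [p] only serve
    to let [b] act on [M] as [p b] acts on the [A] side: [Ind p M] is the
    extension of scalars of [M] along [p : B -> A]. It is characterized by a
    universal property: the map [ind_unit : v |-> 1 (x) [v]] is semilinear
    along [p], and every map [h : M -> W] into an [A]-module that is semilinear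
    along [p] extends uniquely to an [A]-linear map on [Ind p M]
    ([ind_lift], [ind_unit_ext]).

    For [p : C -> B] and [q : B -> A], a map out of [Ind q (Ind p M)] is then
    the same thing as a map out of [Ind p M] semilinear along [q], hence as a
    map out of [M] semilinear along [q \o p], hence as a map out of
    [Ind (q \o p) M]. The two [A]-modules therefore represent the same functor,
    and the isomorphism is the one matching their universal maps from [M].
    Inverse and naturality equations are equalities of semilinear maps, so they
    need only be tested on these universal maps.

    To avoid turning an [A]-module into a [B]-module by restriction of scalars,
    the universal property of [Ind p M] is proved directly for maps that are
    semilinear along a further morphism [q : B -> A]; taking [q] to be the
    identity gives the linear case. *)

Section Unit.
Variables (B A : pzRingType) (p : {rmorphism B -> A}) (M : lmodType B).

Definition ind_unit (v : M) : Ind_obj p M :=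
  tensor (val : im_ring p -> A) 1 (qclass p v).

Lemma ind_unit_zmod : zmod_morphism ind_unit.
Proof.
have unitD u v : ind_unit (u + v) = ind_unit u + ind_unit v.
  by rewrite /ind_unit raddfD; exact: tensorDr.
by move=> x y; rewrite -[in RHS](subrK y x) [in RHS]unitD addrK.
Qed.
HB.instance Definition _ :=
  GRing.isZmodMorphism.Build M (Ind_obj p M) ind_unit ind_unit_zmod.

Lemma tensor_ind_unit (a : A) v :
  tensor (val : im_ring p -> A) a (qclass p v) = a *: ind_unit v.
Proof. by rewrite [RHS]tensorZ mulr1. Qed.

(** The scalar [p b] lies in the image of [p], so it can cross the tensor
    sign, where it acts on classes through [b]. *)
Lemma ind_unitZ b v : ind_unit (b *: v) = p b *: ind_unit v.
Proof.
have pb : p b \in im_pred p by apply/im_predP; exists b.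
rewrite -tensor_ind_unit -[p b]mul1r -[p b]/(val (ImRing pb)).
by rewrite [RHS]tensor_bal (@qclassZ _ _ p _ (ImRing pb) b).
Qed.

End Unit.

Arguments ind_unit {B A} p {M} v.

Section UniversalProperty.
Variables (C B A : pzRingType) (p : {rmorphism C -> B}) (q : {rmorphism B -> A}).
Variables (M : lmodType C) (W : lmodType A).

(** The elements [b *: ind_unit v] generate [Ind p M] additively. *)
Lemma ind_unit_ext (f g : {additive Ind_obj p M -> W}) :
    (forall b x, f (b *: x) = q b *: f x) ->
    (forall b x, g (b *: x) = q b *: g x) ->
  (forall v, f (ind_unit p v) = g (ind_unit p v)) -> f =1 g.
Proof.
move=> fZ gZ fg; apply: tens_ext => b n; have [v ->] := qclassP n.
by rewrite tensor_ind_unit fZ gZ fg.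
Qed.

Variable h : {additive M -> W}.
Hypothesis hZ : forall c v, h (c *: v) = q (p c) *: h v.

(** A map semilinear along [q \o p] kills all of [ker (q \o p) M], in
    particular [ker p M], so it factors through the classes. *)
Lemma semilinear_ker x : @kerM_gen _ _ p M x -> h x = 0.
Proof. by move=> [c [v [pc ->]]]; rewrite hZ pc raddf0 scale0r. Qed.

Lemma balanced_semilinear :
  balanced (val : im_ring p -> B)
    (fun b (n : quotker p M) => q b *: zlift semilinear_ker n).
Proof.
split=> [a a' n|a n n'|a s n]; first by rewrite raddfD scalerDl.
  by rewrite raddfD scalerDr.
have [v ->] := qclassP n.
rewrite (qclassZ _ (im_liftK s)) /qclass !zliftE hZ im_liftK.
by rewrite rmorphM scalerA.
Qed.

Definition ind_lift : Ind_obj p M -> W := tlift balanced_semilinear.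

Lemma ind_lift_zmod : zmod_morphism ind_lift.
Proof. exact: tlift_zmod. Qed.
HB.instance Definition _ :=
  GRing.isZmodMorphism.Build (Ind_obj p M) W ind_lift ind_lift_zmod.

Lemma ind_lift_unit v : ind_lift (ind_unit p v) = h v.
Proof. by rewrite /ind_lift [LHS]tliftE rmorph1 scale1r /qclass zliftE. Qed.

Lemma ind_liftZ b x : ind_lift (b *: x) = q b *: ind_lift x.
Proof.
move: x; apply: (@tens_ext _ _ _ _ _ (ind_lift \o *:%R b) ( *:%R (q b) \o ind_lift)).
move=> b' n; rewrite /= tensorZ /ind_lift [LHS]tliftE [in RHS]tliftE.
by rewrite rmorphM scalerA.
Qed.

End UniversalProperty.

Section LinearLift.
Variables (B A : pzRingType) (p : {rmorphism B -> A}).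
Variables (M : lmodType B) (W : lmodType A).

Lemma ind_hom_ext (f g : {linear Ind_obj p M -> W}) :
  (forall v, f (ind_unit p v) = g (ind_unit p v)) -> f = g.
Proof.
move=> fg; apply: linear_ext.
by apply: (ind_unit_ext (q := idfun)) => // a x; exact: linearZ.
Qed.

Variable h : {additive M -> W}.
Hypothesis hZ : forall b v, h (b *: v) = p b *: h v.

Definition ind_hom : Ind_obj p M -> W := ind_lift (q := idfun) hZ.

Lemma ind_hom_zmod : zmod_morphism ind_hom.
Proof. exact: ind_lift_zmod. Qed.
HB.instance Definition _ :=
  GRing.isZmodMorphism.Build (Ind_obj p M) W ind_hom ind_hom_zmod.

Lemma ind_hom_scalable : scalable ind_hom.
Proof. exact: ind_liftZ. Qed.
HB.instance Definition _ :=
  GRing.isScalable.Build _ _ _ _ ind_hom ind_hom_scalable.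

Lemma ind_hom_unit v : ind_hom (ind_unit p v) = h v.
Proof. exact: ind_lift_unit. Qed.

End LinearLift.

Lemma Ind_map_unit (B A : pzRingType) (p : {rmorphism B -> A}) (M N : lmodType B)
    (f : {linear M -> N}) v :
  (@Ind_map _ _ p M N f : {linear Ind_obj p M -> Ind_obj p N}) (ind_unit p v) =
  ind_unit p (f v).
Proof. exact: Ind_mapE. Qed.

Section Composition.
Variables (C B A : pzRingType) (p : {rmorphism C -> B}) (q : {rmorphism B -> A}).
Local Notation qp := (q \o p : {rmorphism C -> A}).

Section Object.
Variable M : lmodType C.
Local Notation Ind2 := (Ind_obj q (Ind_obj p M) : lmodType A).
Local Notation Ind1 := (Ind_obj qp M : lmodType A).

(** On generators, [a (x) [b (x) [v]]] is sent to [(a * q b) (x) [v]]; the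
    inner lift is semilinear along [q], which is what the outer one requires. *)
Definition ind_fuse : {linear Ind2 -> Ind1} :=
  ind_hom (ind_liftZ (q := q) (ind_unitZ qp (M := M))).

Lemma ind_fuse_unit v : ind_fuse (ind_unit q (ind_unit p v)) = ind_unit qp v.
Proof. by rewrite /ind_fuse [LHS]ind_hom_unit /= ind_lift_unit. Qed.

Lemma ind_unit2Z c (v : M) :
  (ind_unit q \o ind_unit p) (c *: v) = qp c *: (ind_unit q \o ind_unit p) v.
Proof. by rewrite /= !ind_unitZ. Qed.

(** On generators, [a (x) [v]] is sent to [a (x) [1 (x) [v]]]. *)
Definition ind_split : {linear Ind1 -> Ind2} := ind_hom ind_unit2Z.

Lemma ind_split_unit v : ind_split (ind_unit qp v) = ind_unit q (ind_unit p v).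
Proof. exact: ind_hom_unit. Qed.

(** Uniqueness is used twice: over [A] it reduces the claim to the elements
    [ind_unit q x], and the maps [x |-> f (ind_unit q x)], being semilinear
    along [q], are determined on [Ind p M] by their values on [M]. *)
Lemma ind2_hom_ext (W : lmodType A) (f g : {linear Ind2 -> W}) :
  (forall v, f (ind_unit q (ind_unit p v)) = g (ind_unit q (ind_unit p v))) ->
  f = g.
Proof.
move=> fg; apply: ind_hom_ext.
apply: (@ind_unit_ext _ _ _ p q M W (f \o ind_unit q) (g \o ind_unit q)) => //= b x;
  by rewrite ind_unitZ linearZ.
Qed.

End Object.

Lemma Ind_comp : nat_iso (fcomp (Ind q) (Ind p)) (Ind qp).
Proof.
exists ind_fuse; split=> [M N f|M].
  apply: ind2_hom_ext => v /=.
  by rewrite !Ind_map_unit !ind_fuse_unit Ind_map_unit.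
exists (ind_split M); split.
  by apply: ind2_hom_ext => v /=; rewrite ind_fuse_unit ind_split_unit.
by apply: ind_hom_ext => v /=; rewrite ind_split_unit ind_fuse_unit.
Qed.

End Composition.

Theorem proposition2p8 (R : realType) (A B C : ualgType R[i])
    (phi : ualgHom C B) (pi : ualgHom B A) :
  nat_iso (fcomp (Ind pi) (Ind phi)) (Ind (ualg_comp pi phi)).
Proof. exact: Ind_comp. Qed.
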